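(* Let $(T,d)$ be a finite metric tree with at least two vertices, and let $\Gamma_T=\inf_{D(\vec\omega)}\gamma_D(\vec\omega)$ denote the $1$-negative type gap of $(T,d)$. Then $$\Gamma_T=\Bigl\{\sum_{e\in E(T)}|e|^{-1}\Bigr\}^{-1}.$$
   Context: A finite metric tree $(T,d)$ is a finite connected graph $T$ without cycles (identified with its vertex set), each edge carrying a positive weight, where $d(x,y)$ is the sum of the weights of the edges on the unique path from $x$ to $y$. $E(T)$ is the set of edges and $|e|=d(x,y)$ for an edge $e=(x,y)$. For $q,t\in\mathbb{N}=\{1,2,\dots\}$, a normalized $(q,t)$-simplex $D(\vec\omega)=[a_j(m_j);b_i(n_i)]_{q,t}$ in a metric space $(X,d)$ consists of $q+t$ pairwise distinct points $a_1,\dots,a_q,b_1,\dots,b_t\in X$ together with positive weights $\vec\omega=(m_1,\dots,m_q,n_1,\dots,n_t)$ satisfying $\sum_j m_j=1=\sum_i n_i$. Its simplex gap is $$\gamma_D(\vec\omega)=\sum_{j=1}^{q}\sum_{i=1}^{t} m_jn_i\,d(a_j,b_i)-\sum_{1\le j_1<j_2\le q}m_{j_1}m_{j_2}\,d(a_{j_1},a_{j_2})-\sum_{1\le i_1<i_2\le t}n_{i_1}n_{i_2}\,d(b_{i_1},b_{i_2}).$$ The $1$-negative type gap of $(X,d)$ is $\Gamma_X=\inf\gamma_D(\vec\omega)$, the infimum over all $q,t\in\mathbb{N}$ and all normalized $(q,t)$-simplexes $D(\vec\omega)$ in $X$. *)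

(* Defs.v *)
From HB Require Import structures.
From mathcomp Require Import all_boot all_order all_algebra.
From mathcomp Require Import all_classical all_reals ereal.

Set Implicit Arguments.
Unset Strict Implicit.
Unset Printing Implicit Defensive.

Import Order.TTheory GRing.Theory Num.Theory.
Local Open Scope classical_set_scope.
Local Open Scope ring_scope.

(* Only the values of [tree_weight] on adjacent pairs are meaningful. *)
Record metric_tree (R : realType) (T : finType) := MetricTree {
  tree_adj : rel T;
  tree_weight : T -> T -> R;
  tree_adj_sym : symmetric tree_adj;
  tree_adj_irr : irreflexive tree_adj;
  tree_connected : forall x y, connect tree_adj x y;
  tree_acyclic : forall c : seq T, (2 < size c)%N -> ~ ucycle tree_adj c;
  tree_weight_sym :
    forall x y, tree_adj x y -> tree_weight x y = tree_weight y x;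
  tree_weight_gt0 : forall x y, tree_adj x y -> 0 < tree_weight x y
}.

Section TreeDistance.
Variables (R : realType) (T : finType) (G : metric_tree R T).

(* As in path.v, a path is given by its origin [x] and the sequence [p] of the
   vertices that follow. *)
Definition simple_path (x y : T) (p : seq T) : Prop :=
  [/\ path (tree_adj G) x p, last x p = y & uniq (x :: p)].

(* [zip (x :: p) p] lists the consecutive pairs of [x :: p]. *)
Definition path_weight (x : T) (p : seq T) : R :=
  \sum_(s <- zip (x :: p) p) tree_weight G s.1 s.2.

(* The simple path exists by connectedness and is unique by acyclicity, so the
   default value and the choice made by [xget] are immaterial. *)
Definition tree_dist (x y : T) : R :=
  path_weight x (xget [::] [set p | simple_path x y p]).

(* Each (unordered) edge is represented once, by the pair of its endpoints
   listed in the order of the enumeration of [T]. *)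
Definition tree_edges : {set T * T} :=
  [set s : T * T |
    tree_adj G s.1 s.2 && (enum_rank s.1 < enum_rank s.2)%N]%SET.

End TreeDistance.

Record normalized_simplex (R : realType) (X : Type) (q t : nat) :=
  NormalizedSimplex {
  spt_a : 'I_q -> X;
  spt_b : 'I_t -> X;
  swt_m : 'I_q -> R;
  swt_n : 'I_t -> R;
  spt_a_inj : injective spt_a;
  spt_b_inj : injective spt_b;
  spt_ab_neq : forall j i, spt_a j <> spt_b i;
  swt_m_gt0 : forall j, 0 < swt_m j;
  swt_n_gt0 : forall i, 0 < swt_n i;
  swt_m_sum : \sum_(j < q) swt_m j = 1;
  swt_n_sum : \sum_(i < t) swt_n i = 1
}.

Definition simplex_gap (R : realType) (X : Type) (d : X -> X -> R) (q t : nat)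
    (D : normalized_simplex R X q t) : R :=
  (\sum_(j < q) \sum_(i < t)
      swt_m D j * swt_n D i * d (spt_a D j) (spt_b D i))
  - (\sum_(j1 < q) \sum_(j2 < q | (j1 < j2)%N)
      swt_m D j1 * swt_m D j2 * d (spt_a D j1) (spt_a D j2))
  - (\sum_(i1 < t) \sum_(i2 < t | (i1 < i2)%N)
      swt_n D i1 * swt_n D i2 * d (spt_b D i1) (spt_b D i2)).

(* The infimum is taken in the extended reals, where it exists
   unconditionally. *)
Definition one_negative_type_gap (R : realType) (X : Type) (d : X -> X -> R) :
    \bar R :=
  ereal_inf [set g | exists (q t : nat) (D : normalized_simplex R X q t),
    [/\ (0 < q)%N, (0 < t)%N & g = (simplex_gap d D)%:E]].

(* Main.v *)
Require Import Defs.
From HB Require Import structures.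
From mathcomp Require Import all_boot all_order all_algebra.
From mathcomp Require Import all_classical all_reals ereal.
From mathcomp Require Import ring lra.

Set Implicit Arguments.
Unset Strict Implicit.
Unset Printing Implicit Defensive.

Import Order.TTheory GRing.Theory Num.Theory.
Local Open Scope classical_set_scope.
Local Open Scope ring_scope.

(** Deleting an edge s of the tree leaves two components, and the distance
    d(x, y) is the sum of the weights |s| of the edges s whose deletion
    separates x from y.  So d is a weighted sum of the squared differences
    (1_s(x) - 1_s(y))^2, where 1_s is the indicator of one of the two sides of
    s ([tree_dist_cut]).  For a squared difference on the line, the simplex gap
    is the squared difference of the two barycentres ([gap_line]).  Hence the
    gap of a simplex D is the energy

      sum_s |s| c_s^2,

    where c_s is the net mass of D on one side of s ([simplex_gap_cut]).  The
    number c_s can be read as the flow that must cross the edge s in order to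
    carry the masses at the a_j to the b_i, the edge s being a resistor of
    resistance |s|.

    Lower bound.  The points a_j and b_i are distinct, so the whole unit of mass
    at the a_j has to cross some edge, and sum_s |c_s| >= 1.  This is obtained
    by duality: every function g on the vertices is, up to a constant, the sum
    of (g(u) - g(v)) 1_s over the edges s = (u, v) ([potential_diff]), and it
    suffices to pair D with the indicator g of the points a_j.  The
    Cauchy-Schwarz inequality then gives sum_s |s| c_s^2 >= 1 / K with
    K = sum_s 1 / |s|.

    Attainment.  Equality holds when c_s = +-1 / (K |s|) for every edge s.  Such
    a flow has sum_s |c_s| = 1, and it carries total mass 1, as a simplex
    requires, if it leaves the vertices of one set and enters those outside
    it.  A tree is bipartite, so one can let the flow go from the vertices of
    one colour to those of the other; the mass at a vertex x is then the sum of
    1 / (K |s|) over the edges s at x. *)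

(** * The gap of points on a line, for the squared distance *)

Section QuadraticIdentities.
Variable R : realType.

Lemma sum_lt_symm (n : nat) (F : 'I_n -> 'I_n -> R) :
  (forall i j, F i j = F j i) -> (forall i, F i i = 0) ->
  (\sum_(i < n) \sum_(j < n | (i < j)%N) F i j) *+ 2 =
  \sum_(i < n) \sum_(j < n) F i j.
Proof.
move=> Fsym F0; rewrite mulr2n.
have -> : \sum_(i < n) \sum_(j < n) F i j =
    \sum_(i < n) (\sum_(j < n | (i < j)%N) F i j +
                  \sum_(j < n | (j < i)%N) F i j).
  apply: eq_bigr => i _.
  rewrite (bigID (fun j : 'I_n => (i < j)%N)) /=; congr (_ + _).
  rewrite (bigD1 i) /=; last by rewrite ltnn.
  rewrite F0 add0r; apply: eq_bigl => j.
  by rewrite -leqNgt ltn_neqAle andbC.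
rewrite big_split /=; congr (_ + _).
rewrite (exchange_big_dep xpredT) //=.
by apply: eq_bigr => i _; apply: eq_bigr => j _; rewrite Fsym.
Qed.

Lemma sum_mul_sqr_diff (q t : nat) (m al : 'I_q -> R) (n be : 'I_t -> R) :
  \sum_j m j = 1 -> \sum_i n i = 1 ->
  \sum_j \sum_i m j * n i * (al j - be i) ^+ 2 =
  \sum_j m j * al j ^+ 2 - (\sum_j m j * al j) * (\sum_i n i * be i) *+ 2 +
  \sum_i n i * be i ^+ 2.
Proof.
move=> sm sn.
rewrite [LHS](_ : _ = \sum_j (m j * al j ^+ 2
   - m j * al j * (\sum_i n i * be i) *+ 2
   + m j * \sum_i n i * be i ^+ 2)); last first.
  apply: eq_bigr => j _.
  rewrite -[X in X - _ + _]mulr1 -{1}sn !mulr_sumr -sumrMnl -sumrB -big_split.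
  by apply: eq_bigr => i _ /=; ring.
by rewrite big_split sumrB sumrMnl -!mulr_suml sm mul1r.
Qed.

(** With total masses 1, both the cross term and the two inner terms expand
    into the same second moments, which cancel; only the square of the
    difference of the barycentres survives. *)
Lemma gap_line (q t : nat) (m al : 'I_q -> R) (n be : 'I_t -> R) :
  \sum_j m j = 1 -> \sum_i n i = 1 ->
  \sum_j \sum_i m j * n i * (al j - be i) ^+ 2
  - \sum_(j1 < q) \sum_(j2 < q | (j1 < j2)%N)
      m j1 * m j2 * (al j1 - al j2) ^+ 2
  - \sum_(i1 < t) \sum_(i2 < t | (i1 < i2)%N)
      n i1 * n i2 * (be i1 - be i2) ^+ 2
  = (\sum_j m j * al j - \sum_i n i * be i) ^+ 2.
Proof.
move=> sm sn.
have Esym k (v x : 'I_k -> R) (i j : 'I_k) :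
  v i * v j * (x i - x j) ^+ 2 = v j * v i * (x j - x i) ^+ 2 by ring.
have E0 k (v x : 'I_k -> R) (i : 'I_k) :
  v i * v i * (x i - x i) ^+ 2 = 0 by ring.
have := sum_lt_symm (Esym _ m al) (E0 _ m al).
have := sum_lt_symm (Esym _ n be) (E0 _ n be).
rewrite !sum_mul_sqr_diff //.
move: (\sum_(i < q) \sum_(j < q | _) _) (\sum_(i < t) \sum_(j < t | _) _).
move=> A B; nra.
Qed.

End QuadraticIdentities.

(** * Edge cuts and the path distance *)

Section Tree.
Variables (R : realType) (T : finType) (G : metric_tree R T).

Definition adj_minus (s : T * T) : rel T :=
  [rel x y | tree_adj G x y && ((x, y) != s) && ((y, x) != s)].

(** The component of [s.1] once the edge [s] is deleted.  Defining it by
    connectedness, and not by comparing distances to the two ends, makes it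
    independent of the choice of paths. *)
Definition side (s : T * T) (x : T) : bool := connect (adj_minus s) s.1 x.

Definition sideR (s : T * T) (x : T) : R := (side s x)%:R.

Lemma adj_minus_sym s : symmetric (adj_minus s).
Proof.
move=> x y.
by rewrite /adj_minus /= tree_adj_sym -!andbA [in RHS](andbC (_ != s)).
Qed.

Lemma side_adj_minus s x y : adj_minus s x y -> side s x = side s y.
Proof.
move=> exy; apply: same_connect_r; last exact: connect1.
exact/sym_connect_sym/adj_minus_sym.
Qed.

Lemma side1 s : side s s.1.
Proof. exact: connect0. Qed.

(** A path from [s.1] to [s.2] avoiding [s] would close up with [s] into a
    cycle. *)
Lemma side2 s : tree_adj G s.1 s.2 -> ~~ side s s.2.
Proof.
move=> es; apply/negP => /connectP[p ep lp].
have ns : s.1 != s.2 by apply: contraTneq es => ->; rewrite tree_adj_irr.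
case/shortenP: ep lp => p' ep' up' _ lp.
apply: (@tree_acyclic _ _ G (s.1 :: p')).
- case: p' ep' up' lp => [|z [|z' p']] //= ep' _ lp.
    by rewrite lp eqxx in ns.
  by move: ep'; rewrite -lp /adj_minus /= -surjective_pairing eqxx andbF.
- rewrite /ucycle up' andbT /= rcons_path -lp tree_adj_sym es andbT.
  by apply: sub_path ep' => x y /andP[/andP[]].
Qed.

Lemma edge_adj s : s \in tree_edges G -> tree_adj G s.1 s.2.
Proof. by rewrite inE => /andP[]. Qed.

Lemma adj_edge x y :
  tree_adj G x y -> (x, y) \in tree_edges G \/ (y, x) \in tree_edges G.
Proof.
move=> exy; rewrite !inE /= [tree_adj G y x]tree_adj_sym exy /=.
case: (ltngtP (enum_rank x) (enum_rank y)); [by left|by right|].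
move=> /ord_inj/enum_rank_inj exy'.
by rewrite exy' tree_adj_irr in exy.
Qed.

(** The crossing of edges and cuts is the identity matrix: along an edge, the
    only cut indicator that changes is its own.  The signs agree because both
    edges are oriented by the enumeration of the vertices. *)
Lemma sideR_edge s t : s \in tree_edges G -> t \in tree_edges G ->
  sideR s t.1 - sideR s t.2 = (t == s)%:R.
Proof.
move=> Es Et; have [->|ts] := eqVneq t s.
  by rewrite /sideR side1 (negbTE (side2 (edge_adj Es))) subr0.
rewrite /sideR (@side_adj_minus s t.1 t.2) ?subrr //.
rewrite /adj_minus /= edge_adj //= -surjective_pairing ts /=.
apply: contraTneq Es => <-.
rewrite inE /= negb_and -leqNgt; move: Et; rewrite inE => /andP[_ /ltnW ->].
exact: orbT.
Qed.

Lemma sum_edge_delta (F : T * T -> R) t : t \in tree_edges G ->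
  \sum_(s in tree_edges G) F s * (t == s)%:R = F t.
Proof.
move=> Et; rewrite (bigD1 t) //= eqxx mulr1 big1 ?addr0 // => s /andP[_].
by rewrite eq_sym => /negbTE->; rewrite mulr0.
Qed.

(** By [sideR_edge] the formula holds when [x] and [y] are adjacent, and it
    telescopes along a path. *)
Lemma potential_diff (g : T -> R) x y :
  g x - g y = \sum_(s in tree_edges G)
                (g s.1 - g s.2) * (sideR s x - sideR s y).
Proof.
have /connectP[p ep ->] := tree_connected G x y.
elim: p x ep => [|z p IHp] x /=.
  by move=> _; rewrite subrr big1 // => s _; rewrite subrr mulr0.
case/andP=> exz /IHp {}IHp.
rewrite -(subrKA (g z)) IHp [RHS](eq_bigr (fun s =>
  (g s.1 - g s.2) * (sideR s x - sideR s z) +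
  (g s.1 - g s.2) * (sideR s z - sideR s (last z p)))); last first.
  by move=> s _; rewrite -mulrDr addrA subrK.
rewrite big_split; congr (_ + _).
have step a b : (a, b) \in tree_edges G ->
    g a - g b = \sum_(s in tree_edges G)
                  (g s.1 - g s.2) * (sideR s a - sideR s b).
  move=> E; rewrite -[LHS](sum_edge_delta (fun s => g s.1 - g s.2) E).
  by apply: eq_bigr => s Es; rewrite -(sideR_edge Es E).
case: (adj_edge exz) => [/step//|/step E].
rewrite -opprB E -sumrN; apply: eq_bigr => s _.
by rewrite -mulrN opprB.
Qed.

Lemma weight_adj x y : tree_adj G x y ->
  tree_weight G x y = \sum_(s in tree_edges G)
    tree_weight G s.1 s.2 * (sideR s x - sideR s y) ^+ 2.
Proof.
have step a b : (a, b) \in tree_edges G -> tree_weight G a b =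
    \sum_(s in tree_edges G)
    tree_weight G s.1 s.2 * (sideR s a - sideR s b) ^+ 2.
  move=> E; rewrite -[LHS](sum_edge_delta (fun s => tree_weight G s.1 s.2) E).
  apply: eq_bigr => s Es; rewrite (sideR_edge Es E).
  by case: eqP; rewrite ?expr1n ?expr0n.
move=> exy; case: (adj_edge exy) => [/step//|/step E].
rewrite tree_weight_sym // E; apply: eq_bigr => s _.
by rewrite -opprB sqrrN.
Qed.

(** A path that misses an end of the edge [s] cannot use [s], so it stays on
    one side. *)
Lemma side_avoid s x z p : path (tree_adj G) z p -> x \notin z :: p ->
  (x == s.1) || (x == s.2) -> side s z = side s (last z p).
Proof.
move=> ep xp xs; elim: p z ep xp => [//|y p IHp] z /= /andP[ezy ep].
rewrite !inE !negb_or => /and3P[xz xy xp].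
rewrite (@side_adj_minus s z y); first by apply: IHp; rewrite // inE negb_or xy.
rewrite /adj_minus /= ezy /=; case/orP: xs => /eqP E; subst x;
by apply/andP; split; apply/eqP => E; subst s; rewrite /= ?eqxx in xz xy.
Qed.

(** Each cut is crossed at most once by a simple path: after its first step
    across [s] it never returns to the end of [s] it came from, so the squared
    differences add up along the path. *)
Lemma path_weight_cut x p : path (tree_adj G) x p -> uniq (x :: p) ->
  path_weight G x p = \sum_(s in tree_edges G)
    tree_weight G s.1 s.2 * (sideR s x - sideR s (last x p)) ^+ 2.
Proof.
elim: p x => [|z p IHp] x /=.
  move=> _ _; rewrite /path_weight /= big_nil big1 // => s _.
  by rewrite subrr expr0n mulr0.
case/andP=> exz ep /andP[xp up].
rewrite /path_weight /= big_cons /= -/(path_weight G z p).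
have -> := IHp _ ep up; rewrite (weight_adj exz) -big_split.
apply: eq_bigr => s _ /=; rewrite -mulrDr; congr (_ * _).
(* Of the two squares on the left, at least one vanishes. *)
have [E|N] := boolP (adj_minus s x z).
  by rewrite /sideR (side_adj_minus E) subrr expr0n add0r.
have xs : (x == s.1) || (x == s.2).
  move: N; rewrite /adj_minus /= exz /= negb_and !negbK.
  by case/orP=> /eqP<-; rewrite eqxx ?orbT.
have -> : sideR s z = sideR s (last z p).
  by rewrite /sideR (side_avoid ep xp xs).
by rewrite subrr expr0n addr0.
Qed.

Lemma tree_dist_cut x y : tree_dist G x y = \sum_(s in tree_edges G)
  tree_weight G s.1 s.2 * (sideR s x - sideR s y) ^+ 2.
Proof.
have : exists p, simple_path G x y p.
  have /connectP[p0 ep0 ->] := tree_connected G x y.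
  by case/shortenP: ep0 => p ep up _; exists p.
move/(xgetPex [::]).
rewrite /tree_dist; set p := xget _ _ => -[ep <- up].
exact: path_weight_cut.
Qed.

Lemma tree_dist_edge s : s \in tree_edges G ->
  tree_dist G s.1 s.2 = tree_weight G s.1 s.2.
Proof. by move=> Es; rewrite tree_dist_cut -weight_adj // edge_adj. Qed.

Lemma edge_gt0 s : s \in tree_edges G -> 0 < tree_weight G s.1 s.2.
Proof. by move=> Es; apply/tree_weight_gt0/edge_adj. Qed.

(** * The gap as an energy *)

Definition flow q t (D : normalized_simplex R T q t) (s : T * T) : R :=
  \sum_j swt_m D j * sideR s (spt_a D j) -
  \sum_i swt_n D i * sideR s (spt_b D i).

(** The gap is linear in the distance, and [tree_dist_cut] writes the distance
    as a combination of squared differences, to which [gap_line] applies. *)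
Lemma simplex_gap_cut q t (D : normalized_simplex R T q t) :
  simplex_gap (tree_dist G) D =
  \sum_(s in tree_edges G) tree_weight G s.1 s.2 * flow D s ^+ 2.
Proof.
have pull (I J : finType) (P : I -> pred J) (c : I -> J -> R)
    (a : I -> T) (b : J -> T) :
    \sum_i \sum_(j | P i j) c i j * tree_dist G (a i) (b j) =
    \sum_(s in tree_edges G) tree_weight G s.1 s.2 *
      \sum_i \sum_(j | P i j) c i j * (sideR s (a i) - sideR s (b j)) ^+ 2.
  under [RHS]eq_bigr do rewrite mulr_sumr.
  rewrite exchange_big; apply: eq_bigr => i _ /=.
  under [RHS]eq_bigr do rewrite mulr_sumr.
  rewrite exchange_big; apply: eq_bigr => j _ /=.
  rewrite tree_dist_cut mulr_sumr; apply: eq_bigr => s _; ring.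
rewrite /simplex_gap !pull -!sumrB; apply: eq_bigr => s _.
by rewrite -!mulrBr gap_line ?swt_m_sum ?swt_n_sum.
Qed.

(** Summation by parts: [potential_diff] integrated against the signed measure
    of [D], whose total mass 0 kills the constant. *)
Lemma flow_pairing q t (D : normalized_simplex R T q t) (g : T -> R) :
  \sum_j swt_m D j * g (spt_a D j) - \sum_i swt_n D i * g (spt_b D i) =
  \sum_(s in tree_edges G) (g s.1 - g s.2) * flow D s.
Proof.
case: q D => [|q] D.
  by have /eqP := swt_m_sum D; rewrite big_ord0 eq_sym oner_eq0.
pose o := spt_a D ord0.
have avg k (w : 'I_k -> R) (a : 'I_k -> T) : \sum_j w j = 1 ->
    \sum_j w j * g (a j) = g o + \sum_(s in tree_edges G)
      (g s.1 - g s.2) * (\sum_j w j * sideR s (a j) - sideR s o).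
  move=> w1; rewrite -[g o]mulr1 -w1.
  have E s : (g s.1 - g s.2) * (\sum_j w j * sideR s (a j) - sideR s o) =
     \sum_j w j * ((g s.1 - g s.2) * (sideR s (a j) - sideR s o)).
    rewrite [RHS](eq_bigr (fun j => (g s.1 - g s.2) *
      (w j * sideR s (a j) - w j * sideR s o))) => [|j _]; last by ring.
    by rewrite -mulr_sumr sumrB -mulr_suml w1 mul1r.
  under [X in _ = _ + X]eq_bigr do rewrite E.
  rewrite exchange_big mulr_sumr -big_split; apply: eq_bigr => j _ /=.
  by rewrite -mulr_sumr -potential_diff; ring.
rewrite !avg ?swt_m_sum ?swt_n_sum // opprD addrACA subrr add0r -sumrB.
by apply: eq_bigr => s _; rewrite /flow; ring.
Qed.

(** Pairing with the indicator of the points [spt_a D j] gives 1, and an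
    indicator varies by at most 1 along an edge. *)
Lemma sum_flow_ge1 q t (D : normalized_simplex R T q t) :
  1 <= \sum_(s in tree_edges G) `|flow D s|.
Proof.
pose g x : R := (x \in codom (spt_a D))%:R.
have <- : \sum_j swt_m D j * g (spt_a D j) -
          \sum_i swt_n D i * g (spt_b D i) = 1.
  rewrite [X in _ - X]big1 => [|i _].
    rewrite subr0 -[RHS](swt_m_sum D); apply: eq_bigr => j _.
    by rewrite /g codom_f mulr1.
  rewrite /g; case: codomP => [[j E]|_]; last by rewrite mulr0.
  by case: (@spt_ab_neq _ _ _ _ D j i).
rewrite flow_pairing; apply: le_trans (ler_norm _) _.
apply: le_trans (ler_norm_sum _ _ _) _; apply: ler_sum => s _.
rewrite normrM ler_piMl // /g.
by do 2 case: (_ \in _); rewrite ?subrr ?subr0 ?sub0r ?normrN ?normr1 ?normr0.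
Qed.

(** * The lower bound *)

Hypothesis T_gt1 : (1 < #|T|)%N.

Lemma exists_adj x : exists y, tree_adj G x y.
Proof.
have [y xy] : exists y, y != x.
  by case/card_gt1P: T_gt1 => a [b [_ _ ab]]; have [E|] := eqVneq a x;
    [exists b; rewrite -E eq_sym|exists a].
have /connectP[[|z p] /= ep lp] := tree_connected G x y.
  by rewrite lp eqxx in xy.
by case/andP: ep => exz _; exists z.
Qed.

Definition total_conductance : R :=
  \sum_(s in tree_edges G) (tree_weight G s.1 s.2)^-1.

Local Notation K := total_conductance.

Lemma conductance_gt0 : 0 < K.
Proof.
have pos s : s \in tree_edges G -> 0 < (tree_weight G s.1 s.2)^-1.
  by move=> Es; rewrite invr_gt0 edge_gt0.
case/card_gt1P: T_gt1 => x [_ [_ _ _]].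
have [s Es] : exists s, s \in tree_edges G.
  by have [y /adj_edge[]] := exists_adj x; [exists (x, y)|exists (y, x)].
rewrite /K (bigD1 s) //= ltr_wpDr ?pos //.
by apply: sumr_ge0 => t /andP[/pos/ltW].
Qed.

(** The Cauchy-Schwarz inequality, in its tangent form
    [w c^2 >= 2 |c| / K - 1 / (K^2 w)], with equality at [|c| = 1 / (K w)],
    which is summed over the edges. *)
Lemma simplex_gap_ge q t (D : normalized_simplex R T q t) :
  K^-1 <= simplex_gap (tree_dist G) D.
Proof.
have K0 := conductance_gt0.
rewrite simplex_gap_cut.
have /le_trans : K^-1 <= \sum_(s in tree_edges G)
   (`|flow D s| * (K^-1 *+ 2) - K^-1 ^+ 2 * (tree_weight G s.1 s.2)^-1).
  rewrite sumrB -mulr_suml -mulr_sumr -/K.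
  have -> : K^-1 ^+ 2 * K = K^-1 by field; rewrite gt_eqF.
  have := sum_flow_ge1 D; have : 0 < K^-1 by rewrite invr_gt0.
  move: (\sum_(s in _) _) => S; nra.
apply; apply: ler_sum => s Es.
have w0 := edge_gt0 Es.
rewrite -[flow D s ^+ 2]real_normK ?num_real //.
rewrite -subr_ge0 (_ : _ - _ = tree_weight G s.1 s.2 *
    (`|flow D s| - K^-1 * (tree_weight G s.1 s.2)^-1) ^+ 2).
  by rewrite mulr_ge0 ?sqr_ge0 ?ltW.
by field; rewrite !gt_eqF.
Qed.

(** * A simplex that attains the bound *)

(** The parity of the number of cuts that have [x] on their first side.
    Crossing an edge changes exactly one of these bits, so this is a proper
    2-colouring. *)
Definition colour (x : T) : bool :=
  \big[addb/false]_(s in tree_edges G) side s x.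

Lemma colour_edge s : s \in tree_edges G -> colour s.2 = ~~ colour s.1.
Proof.
move=> Es; have s2 := negbTE (side2 (edge_adj Es)).
rewrite /colour !(bigD1 s Es) /= side1 s2 /= negbK.
apply: eq_bigr => t /andP[Et ts].
have := sideR_edge Et Es; rewrite eq_sym (negbTE ts) => /eqP.
rewrite subr_eq0 /sideR eqr_nat.
by do 2 case: (side t _).
Qed.

Definition degree (x : T) : R :=
  \sum_(s in tree_edges G)
    (tree_weight G s.1 s.2)^-1 * ((x == s.1)%:R + (x == s.2)%:R).

Lemma degree_gt0 x : 0 < degree x.
Proof.
have pos s : s \in tree_edges G ->
    0 <= (tree_weight G s.1 s.2)^-1 * ((x == s.1)%:R + (x == s.2)%:R).
  by move=> /edge_gt0/ltW w0; rewrite mulr_ge0 ?invr_ge0 ?addr_ge0 ?ler0n.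
have key s : s \in tree_edges G -> (x == s.1) || (x == s.2) -> 0 < degree x.
  move=> Es xs; rewrite /degree (bigD1 s) //= ltr_wpDr //.
    by apply: sumr_ge0 => t /andP[/pos].
  rewrite mulr_gt0 ?invr_gt0 ?edge_gt0 //.
  by case/orP: xs => ->; [exact: ltr_wpDr|exact: ltr_wpDl].
have [y exy] := exists_adj x.
by case: (adj_edge exy) => /key; apply; rewrite eqxx ?orbT.
Qed.

Definition optimal_weight (x : T) : R := K^-1 * degree x.

Lemma optimal_weight_gt0 x : 0 < optimal_weight x.
Proof. by rewrite mulr_gt0 ?invr_gt0 ?conductance_gt0 ?degree_gt0. Qed.

(** Handshake: each edge contributes once at each of its two ends. *)
Lemma sum_optimal_weight (g : T -> R) :
  \sum_x optimal_weight x * g x =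
  K^-1 * \sum_(s in tree_edges G)
     (tree_weight G s.1 s.2)^-1 * (g s.1 + g s.2).
Proof.
have pick (y : T) : \sum_x (x == y)%:R * g x = g y.
  rewrite (bigD1 y) //= eqxx mul1r big1 ?addr0 // => x /negbTE->.
  by rewrite mul0r.
under eq_bigr do rewrite /optimal_weight -mulrA mulr_suml.
rewrite -mulr_sumr exchange_big; congr (_ * _); apply: eq_bigr => s _ /=.
under eq_bigr do rewrite -mulrA mulrDl.
by rewrite -mulr_sumr big_split /= !pick.
Qed.

(** Each edge has exactly one end of each colour, so each colour class receives
    its share [1 / (K |s|)] exactly once. *)
Lemma sum_optimal_weight_colour b :
  \sum_(x | colour x == b) optimal_weight x = 1.
Proof.
have /eqP := sum_optimal_weight (fun x => (colour x == b)%:R).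
rewrite (eq_bigr (fun x => if colour x == b then optimal_weight x else 0));
  last first.
  by move=> x _; case: ifP; rewrite ?mulr1 ?mulr0.
rewrite -big_mkcond => /eqP ->.
rewrite (eq_bigr (fun s => (tree_weight G s.1 s.2)^-1)) -/K.
  by rewrite mulVf // gt_eqF // conductance_gt0.
move=> s Es; rewrite (colour_edge Es).
by case: (colour _) b => -[]; rewrite ?addr0 ?add0r mulr1.
Qed.

Lemma sum_enum_val (A : {pred T}) (F : T -> R) :
  \sum_(j < #|A|) F (enum_val j) = \sum_(x in A) F x.
Proof. by rewrite -big_enum_val. Qed.

Definition optimal_simplex :
  normalized_simplex R T #|[pred x | colour x == true]|
                         #|[pred x | colour x == false]|.
Proof.
refine (@NormalizedSimplex R T _ _ enum_val enum_val
  (fun j => optimal_weight (enum_val j))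
  (fun i => optimal_weight (enum_val i)) _ _ _ _ _ _ _).
- exact: enum_val_inj.
- exact: enum_val_inj.
- move=> j i E; have := enum_valP j; rewrite E.
  by have := enum_valP i; rewrite !inE => /eqP->.
- by move=> j; apply: optimal_weight_gt0.
- by move=> i; apply: optimal_weight_gt0.
- rewrite sum_enum_val; exact: sum_optimal_weight_colour.
- rewrite sum_enum_val; exact: sum_optimal_weight_colour.
Defined.

(** The flow through [s] is the pairing of the signed weights with the indicator
    of a side of [s].  The signs are opposite at the ends of an edge, so the
    pairing is a sum of differences of the indicator along the edges, and only
    the edge [s] itself contributes.  Its sign depends on the colour of [s.1]
    and is squared away. *)
Lemma optimal_flow s : s \in tree_edges G ->
  flow optimal_simplex s ^+ 2 = (K^-1 * (tree_weight G s.1 s.2)^-1) ^+ 2.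
Proof.
move=> Es; rewrite /flow /=.
rewrite (sum_enum_val _ (fun x => optimal_weight x * sideR s x)).
rewrite (sum_enum_val _ (fun x => optimal_weight x * sideR s x)).
pose e (x : T) : R := if colour x then 1 else -1.
have -> : \sum_(x in [pred x | colour x == true]) optimal_weight x * sideR s x -
  \sum_(x in [pred x | colour x == false]) optimal_weight x * sideR s x =
  \sum_x optimal_weight x * (e x * sideR s x).
  rewrite [RHS](bigID colour) /= -sumrN; congr (_ + _); apply: eq_big => x;
    rewrite ?inE ?eqb_id ?eqbF_neg // /e => cx.
    by rewrite cx mul1r.
  by rewrite (negbTE cx) mulN1r mulrN.
rewrite sum_optimal_weight.
rewrite (eq_bigr (fun t => (tree_weight G t.1 t.2)^-1 * e t.1 * (s == t)%:R)).
  rewrite (sum_edge_delta (fun t => (tree_weight G t.1 t.2)^-1 * e t.1) Es).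
  by rewrite /e; case: ifP => _; ring.
move=> t Et; rewrite eq_sym -(sideR_edge Es Et) /e (colour_edge Et).
by case: (colour _) => /=; ring.
Qed.

Lemma optimal_gap : simplex_gap (tree_dist G) optimal_simplex = K^-1.
Proof.
have K0 := conductance_gt0.
rewrite simplex_gap_cut.
rewrite (eq_bigr (fun s => K^-1 ^+ 2 * (tree_weight G s.1 s.2)^-1)).
  by rewrite -mulr_sumr -/K; field; rewrite gt_eqF.
move=> s Es; rewrite optimal_flow //; have w0 := edge_gt0 Es.
by field; rewrite !gt_eqF.
Qed.

End Tree.

Lemma simplex_size_gt0 (R : realType) (X : Type) q t
  (D : normalized_simplex R X q t) : (0 < q)%N /\ (0 < t)%N.
Proof.
split; rewrite lt0n; apply/eqP => E; subst.
- by have /eqP := swt_m_sum D; rewrite big_ord0 eq_sym oner_eq0.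
- by have /eqP := swt_n_sum D; rewrite big_ord0 eq_sym oner_eq0.
Qed.

Theorem corollary4p13 (R : realType) (T : finType) (G : metric_tree R T)
    (hT : (2 <= #|T|)%N) :
  one_negative_type_gap (tree_dist G) =
  ((\sum_(s in tree_edges G) (tree_dist G s.1 s.2)^-1)^-1)%:E.
Proof.
rewrite (eq_bigr (fun s => (tree_weight G s.1 s.2)^-1)); last first.
  by move=> s Es; rewrite tree_dist_edge.
rewrite -/(total_conductance G); apply/eqP; rewrite eq_le; apply/andP; split.
- apply: ereal_inf_lbound; exists _, _, (optimal_simplex G hT).
  have [q0 t0] := simplex_size_gt0 (optimal_simplex G hT).
  by split; rewrite ?optimal_gap.
- apply: le_ereal_inf_tmp => _ [q [t [D [_ _ ->]]]].
  by rewrite lee_fin; apply: simplex_gap_ge.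
Qed.
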